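(* Let $k$ be a field of characteristic $0$ and let $\underline{\lambda}$ be a pure tuple of partitions. Then: (a) a universal countable $\underline{\lambda}$-space exists; (b) for every $d\in\mathbf{N}$, a $d$-universal finite $\underline{\lambda}$-space exists; (c) if $V$ is a universal countable $\underline{\lambda}$-space over $k$ and $k'/k$ is any field extension, then $V\otimes_k k'$ is a universal $\underline{\lambda}$-space over $k'$.
   Context: For $\lambda\vdash n$, $\mathbf{S}_\lambda(V)=\operatorname{Hom}_{\mathfrak{S}_n}(S^\lambda,V^{\otimes n})$ with $S^\lambda$ the Specht module; a $\lambda$-form is a linear map $\mathbf{S}_\lambda(V)\to k$. For a tuple $\underline{\lambda}=[\lambda_1,\ldots,\lambda_r]$ of partitions (pure: every $\lambda_i$ non-empty), a $\underline{\lambda}$-space is a $k$-vector space with a $\lambda_i$-form for each $i$. An embedding is an injective linear map pulling back the structure. Finite = finite-dimensional; countable = countably infinite dimensional. $V$ is universal if every finite $\underline{\lambda}$-space embeds into $V$, and $d$-universal if every $d$-dimensional $\underline{\lambda}$-space embeds into $V$. *)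

(* Defs.v *)
From HB Require Import structures.
From mathcomp Require Import all_boot all_fingroup all_algebra generic_quotient.
From mathcomp Require Import boolp classical_sets functions.
From mathcomp Require Import finmap monalg.

Set Implicit Arguments.
Unset Strict Implicit.
Unset Printing Implicit Defensive.

Import GRing.Theory.
Local Open Scope ring_scope.
Local Open Scope quotient_scope.

(******************************************************************************)
(*   quot_mod G == the quotient of the module M by its submodule generated    *)
(*                 by the set G                                               *)
(*    tpow n V  == the n-th tensor power of V, with pure tensors ptensor v    *)
(*  specht k la == the Specht module of la over k                             *)
(*   schur la V == the Schur functor Hom_{S_n}(specht la, V^{(x) n})          *)
(*  lspace k la == the type of la-spaces over k, la a tuple of partitions     *)
(*  ext_scalars iota V, base_change iota V == extension of scalars along      *)
(*                 iota of a vector space, resp. of a la-space                *)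
(******************************************************************************)

Section QuotMod.
Variables (R : nzRingType) (M : lmodType R) (G : M -> Prop).

Definition gen_submod : {pred M} := fun x =>
  `[< forall P : {pred M}, GRing.submod_closed P ->
        (forall g, G g -> g \in P) -> x \in P >].

Lemma gen_submod_subset g : G g -> g \in gen_submod.
Proof. by move=> Gg; apply/asboolP => P _; apply. Qed.

Lemma gen_submod_closed : GRing.submod_closed gen_submod.
Proof.
split=> [|a x y /asboolP Gx /asboolP Gy]; apply/asboolP => P Pclosed PG.
  by case: Pclosed.
by case: (Pclosed) => _; apply; [exact: Gx|exact: Gy].
Qed.

HB.instance Definition _ := GRing.isZmodClosed.Build M gen_submod
  (GRing.submod_closedB gen_submod_closed).

Definition quot_mod := Quotient.quot gen_submod.

HB.instance Definition _ := GRing.Zmodule.on quot_mod.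
HB.instance Definition _ := Quotient.on quot_mod.

Definition quot_mod_pi (x : M) : quot_mod := \pi_quot_mod x.

Lemma quot_mod_piP x y :
  reflect (quot_mod_pi x = quot_mod_pi y) (x - y \in gen_submod).
Proof. by rewrite Quotient.idealrBE; exact: eqP. Qed.

Lemma quot_mod_piD x y : quot_mod_pi (x + y) = quot_mod_pi x + quot_mod_pi y.
Proof. by rewrite /quot_mod_pi !piE. Qed.

Lemma quot_mod_reprK (q : quot_mod) : quot_mod_pi (repr q) = q.
Proof. exact: reprK. Qed.

Lemma gen_submodZ a x : x \in gen_submod -> a *: x \in gen_submod.
Proof.
case: gen_submod_closed => G0 GZ Gx.
by rewrite -[a *: x]addr0; exact: GZ.
Qed.

Definition quot_mod_scale (a : R) (q : quot_mod) : quot_mod :=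
  quot_mod_pi (a *: repr q).

Lemma quot_mod_scale_pi a x :
  quot_mod_scale a (quot_mod_pi x) = quot_mod_pi (a *: x).
Proof.
apply/quot_mod_piP; rewrite -scalerBr; apply: gen_submodZ.
by apply/quot_mod_piP; rewrite quot_mod_reprK.
Qed.

Let scaleA a b q :
  quot_mod_scale a (quot_mod_scale b q) = quot_mod_scale (a * b) q.
Proof. by rewrite -[q]quot_mod_reprK !quot_mod_scale_pi scalerA. Qed.

Let scale1 q : quot_mod_scale 1 q = q.
Proof. by rewrite -[q in LHS]quot_mod_reprK quot_mod_scale_pi scale1r quot_mod_reprK. Qed.

Let scaleDr a : {morph quot_mod_scale a : p q / p + q}.
Proof.
move=> p q; rewrite -[p]quot_mod_reprK -[q]quot_mod_reprK -quot_mod_piD.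
by rewrite !quot_mod_scale_pi scalerDr quot_mod_piD.
Qed.

Let scaleDl q : {morph quot_mod_scale^~ q : a b / a + b}.
Proof.
move=> a b; rewrite -[q]quot_mod_reprK.
by rewrite !quot_mod_scale_pi scalerDl quot_mod_piD.
Qed.

HB.instance Definition _ :=
  GRing.Zmodule_isLmodule.Build R quot_mod scaleA scale1 scaleDr scaleDl.

Lemma quot_mod_pi_is_linear : linear quot_mod_pi.
Proof. by move=> a x y; rewrite quot_mod_piD -quot_mod_scale_pi. Qed.

HB.instance Definition _ :=
  GRing.isLinear.Build R M quot_mod _ quot_mod_pi quot_mod_pi_is_linear.

End QuotMod.

Section FreeLift.
Variables (R S : nzRingType) (sigma : {rmorphism R -> S}).
Variables (K : choiceType) (W : lmodType S) (g : K -> W).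

Definition free_lift (x : {malg R[K]}) : W :=
  \sum_(v <- msupp x) sigma x@_v *: g v.

Lemma free_liftEw (x : {malg R[K]}) (D : {fset K}) :
  fsubset (msupp x) D -> free_lift x = \sum_(v <- D) sigma x@_v *: g v.
Proof.
move=> sub; apply: (big_fset_incl _ sub) => v _ vx /=.
by rewrite mcoeff_outdom // rmorph0 scale0r.
Qed.

Lemma free_liftP : linear_for (sigma \; *:%R) free_lift.
Proof.
move=> a x y; pose D := (msupp x `|` msupp y `|` msupp (a *: x + y))%fset.
rewrite !(@free_liftEw _ D) ?fsubsetUr //; last first.
- by rewrite /D fsubsetU // fsubsetUl.
- by rewrite /D fsubsetU // fsubsetUr.
rewrite /= scaler_sumr -big_split /=; apply: eq_bigr => v _.
by rewrite mcoeffD mcoeffZ rmorphD rmorphM scalerDl scalerA.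
Qed.

Lemma free_liftU v : free_lift << v >> = g v.
Proof.
rewrite (@free_liftEw _ [fset v]%fset) ?msuppU_le // big_seq_fset1.
by rewrite mcoeffUU rmorph1 scale1r.
Qed.

End FreeLift.

Section QuotLift.
Variables (R S : nzRingType) (sigma : {rmorphism R -> S}).
Variables (K : choiceType) (W : lmodType S) (g : K -> W).
Variable G : {malg R[K]} -> Prop.

Definition quot_lift (q : quot_mod G) : W := free_lift sigma g (repr q).

Hypothesis Gg : forall x, G x -> free_lift sigma g x = 0.

Lemma quot_lift_pi x : quot_lift (quot_mod_pi G x) = free_lift sigma g x.
Proof.
have lin := free_liftP sigma g.
have ker y : y \in gen_submod G -> free_lift sigma g y = 0.
  move/asboolP => /(_ (fun y => `[< free_lift sigma g y = 0 >])) kery.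
  apply/asboolP/kery => [|z /Gg z0]; last exact/asboolP.
  split=> [|a u v /asboolP u0 /asboolP v0]; apply/asboolP.
    by rewrite /free_lift msupp0 big_seq_fset0.
  by rewrite lin /= u0 v0 scaler0 addr0.
set y := repr (quot_mod_pi G x).
have /quot_mod_piP/ker : quot_mod_pi G y = quot_mod_pi G x.
  exact: quot_mod_reprK.
rewrite /quot_lift -/y => eq0.
have <- : 1 *: (y - x) + x = y by rewrite scale1r subrK.
by rewrite lin /= eq0 scaler0 add0r.
Qed.

Lemma quot_liftP : linear_for (sigma \; *:%R) quot_lift.
Proof.
move=> a p q; rewrite -[p]quot_mod_reprK -[q]quot_mod_reprK.
rewrite -(linearP (quot_mod_pi G)) !quot_lift_pi.
exact: free_liftP.
Qed.

End QuotLift.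

Section TensorPower.
Variables (k : fieldType) (n : nat) (V : lmodType k).

Definition upd (T : Type) (v : {ffun 'I_n -> T}) (i : 'I_n) (x : T) :
  {ffun 'I_n -> T} := [ffun j => if j == i then x else v j].

Inductive tensor_rel : {malg k[{ffun 'I_n -> V}]} -> Prop :=
| TensorRel v i (a : k) x y :
    tensor_rel (<< upd v i (a *: x + y) >> -
                (a *: << upd v i x >> + << upd v i y >>)).

Definition tpow := quot_mod tensor_rel.
HB.instance Definition _ := GRing.Lmodule.on tpow.

Definition ptensor (v : {ffun 'I_n -> V}) : tpow := quot_mod_pi tensor_rel << v >>.

(* Semilinear version of multilinearity; multilinearity itself is the case    *)
(* sigma = idfun.                                                             *)
Definition multilinear (S : nzRingType) (sigma : {rmorphism k -> S})
    (W : lmodType S) (g : {ffun 'I_n -> V} -> W) :=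
  forall v i a x y,
    g (upd v i (a *: x + y)) = sigma a *: g (upd v i x) + g (upd v i y).

Lemma ptensor_multilinear : multilinear idfun ptensor.
Proof.
move=> v i a x y; rewrite -linearP; apply/quot_mod_piP.
exact/gen_submod_subset/TensorRel.
Qed.

Section Lift.
Variables (S : nzRingType) (sigma : {rmorphism k -> S}) (W : lmodType S).
Variable g : {ffun 'I_n -> V} -> W.

(* The semilinear extension of g along ptensor; it is only meaningful for g   *)
(* multilinear.                                                               *)
Definition tensor_lift (t : tpow) : W := quot_lift sigma g t.

Hypothesis gP : multilinear sigma g.

Lemma free_lift_tensor_rel x : tensor_rel x -> free_lift sigma g x = 0.
Proof.
case=> v i a u w; have lin := free_liftP sigma g.
rewrite addrC -scaleN1r !lin /= !free_liftU gP rmorphN rmorph1 scaleN1r.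
by rewrite addNr.
Qed.

Lemma tensor_liftP : linear_for (sigma \; *:%R) tensor_lift.
Proof. exact/quot_liftP/free_lift_tensor_rel. Qed.

Lemma tensor_lift_ptensor v : tensor_lift (ptensor v) = g v.
Proof.
by rewrite /tensor_lift quot_lift_pi ?free_liftU //; exact: free_lift_tensor_rel.
Qed.

End Lift.

Lemma tpow_ext (S : nzRingType) (sigma : {rmorphism k -> S}) (W : lmodType S)
    (f g : tpow -> W) :
  linear_for (sigma \; *:%R) f -> linear_for (sigma \; *:%R) g ->
  (forall v, f (ptensor v) = g (ptensor v)) -> f =1 g.
Proof.
move=> fP gP fg t; rewrite -[t]quot_mod_reprK; move: (repr _) => x.
have zero h : linear_for (sigma \; *:%R) h -> h (0 : tpow) = 0 :> W.
  move=> hP; have := hP (-1) 0 0; rewrite scaleN1r oppr0 addr0 /=.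
  by rewrite rmorphN rmorph1 scaleN1r addNr.
rewrite [x]monalgE; elim/big_rec: _ => [|v y _ IH].
  by rewrite linear0 !zero.
have -> : << x@_v *g v >> = x@_v *: << v >>.
  by apply/malgP => w; rewrite mcoeffZ !mcoeffU mulrnAr mulr1.
by rewrite linearP fP gP IH fg.
Qed.

(* The i-th factor of a pure tensor is moved to place s i. Like the action on *)
(* Specht modules below, this is a left action for composition of             *)
(* permutations, hence a right action for the product s * t (s then t).       *)
Definition tensor_perm (s : 'S_n) : tpow -> tpow :=
  tensor_lift idfun (fun v => ptensor [ffun i => v ((s^-1)%g i)]).

Lemma tensor_perm_multilinear (s : 'S_n) :
  multilinear idfun (fun v => ptensor [ffun i => v ((s^-1)%g i)]).
Proof.
move=> v i a x y.
have updE z : [ffun j => upd v i z ((s^-1)%g j)]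
            = upd [ffun j => v ((s^-1)%g j)] (s i) z.
  apply/ffunP => j; rewrite !ffunE -(inj_eq (@perm_inj _ s)) permKV.
  by case: ifP.
by rewrite !updE; exact: ptensor_multilinear.
Qed.

Lemma tensor_perm_linear s : linear (tensor_perm s).
Proof. exact/tensor_liftP/tensor_perm_multilinear. Qed.

HB.instance Definition _ s :=
  GRing.isLinear.Build k tpow tpow _ (tensor_perm s) (tensor_perm_linear s).

Lemma tensor_permE s v :
  tensor_perm s (ptensor v) = ptensor [ffun i => v ((s^-1)%g i)].
Proof. exact/tensor_lift_ptensor/tensor_perm_multilinear. Qed.

End TensorPower.

Arguments ptensor {k n V} v.

(* The map V^{(x) n} -> W^{(x) n} induced by a map j : V -> W semilinear      *)
(* along sigma.                                                               *)
Section TensorMap.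
Variables (k k' : fieldType) (sigma : {rmorphism k -> k'}) (n : nat).
Variables (V : lmodType k) (W : lmodType k') (j : V -> W).

Definition tensor_map : tpow n V -> tpow n W :=
  tensor_lift sigma (fun v => ptensor [ffun i => j (v i)]).

Hypothesis jP : linear_for (sigma \; *:%R) j.

Lemma tensor_map_multilinear :
  multilinear sigma (fun v : {ffun 'I_n -> V} => ptensor [ffun i => j (v i)]).
Proof.
move=> v i a x y.
have updE z : [ffun l => j (upd v i z l)] = upd [ffun l => j (v l)] i (j z).
  by apply/ffunP => l; rewrite !ffunE; case: ifP.
by rewrite !updE jP; exact: ptensor_multilinear.
Qed.

Lemma tensor_mapP : linear_for (sigma \; *:%R) tensor_map.
Proof. exact/tensor_liftP/tensor_map_multilinear. Qed.

Lemma tensor_mapE v : tensor_map (ptensor v) = ptensor [ffun i => j (v i)].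
Proof. exact/tensor_lift_ptensor/tensor_map_multilinear. Qed.

Lemma tensor_map_perm s t :
  tensor_map (tensor_perm s t) = tensor_perm s (tensor_map t).
Proof.
move: t; apply: (@tpow_ext _ _ _ _ sigma) => [a t u|a t u|v].
- by rewrite linearP tensor_mapP.
- by rewrite tensor_mapP /= linearP.
rewrite tensor_permE !tensor_mapE tensor_permE; congr ptensor.
by apply/ffunP => i; rewrite !ffunE.
Qed.

End TensorMap.

Record intpart := IntPart {
  parts :> seq nat;
  _ : sorted geq parts && (0%N \notin parts)
}.

Section Specht.
Variables (k : fieldType) (la : intpart).

Notation n := (sumn la).

Definition cell := {i : 'I_(size la) & 'I_(nth 0%N la i)}.
HB.instance Definition _ := Finite.on cell.

Definition cell_row (c : cell) : 'I_(size la) := tag c.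
Definition cell_col (c : cell) : nat := tagged c.

(* A tableau is a filling of the cells by pairwise distinct entries, i.e. an  *)
(* injective t : filling; it is then bijective. A tabloid is represented by   *)
(* the family of its sets of row entries.                                     *)
Definition filling := {ffun cell -> 'I_n}.
Definition tabloid := {ffun 'I_(size la) -> {set 'I_n}}.

Definition filling_act (s : 'S_n) (t : filling) : filling := [ffun c => s (t c)].
Definition tabloid_act (s : 'S_n) (T : tabloid) : tabloid :=
  [ffun i => [set s x | x in T i]].

Definition tabloid_of (t : filling) : tabloid :=
  [ffun i => [set t c | c in [set c | cell_row c == i]]].

Definition column_stab (t : filling) : {set 'S_n} :=
  [set s : 'S_n | [forall c, [exists c',
     (t c' == s (t c)) && (cell_col c' == cell_col c)]]].

Definition tabloid_mod := {ffun tabloid -> k^o}.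
HB.instance Definition _ := Vector.on tabloid_mod.

Definition tabloid_vec (T : tabloid) : tabloid_mod := [ffun T' => (T' == T)%:R].

Definition tabloid_mod_act (s : 'S_n) (x : tabloid_mod) : tabloid_mod :=
  [ffun T => x (tabloid_act (s^-1)%g T)].

Definition polytabloid (t : filling) : tabloid_mod :=
  \sum_(s in column_stab t) (-1) ^+ s *: tabloid_vec (tabloid_of (filling_act s t)).

Definition specht_vs : {vspace tabloid_mod} :=
  (\sum_(t : filling | injectiveb t) <[polytabloid t]>)%VS.

Definition specht := subvs_of specht_vs.
HB.instance Definition _ := Vector.on specht.

Definition specht_act (s : 'S_n) (x : specht) : specht :=
  vsproj specht_vs (tabloid_mod_act s (vsval x)).

Lemma tabloid_actK s : cancel (tabloid_act s) (tabloid_act (s^-1)%g).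
Proof.
move=> T; apply/ffunP => i; rewrite !ffunE -imset_comp.
rewrite (eq_imset (g := id)) ?imset_id // => x /=.
by rewrite permK.
Qed.

Lemma tabloid_actKV s : cancel (tabloid_act (s^-1)%g) (tabloid_act s).
Proof. by move=> T; rewrite -[in X in tabloid_act X](invgK s) tabloid_actK. Qed.

Lemma tabloid_mod_act_linear s : linear (tabloid_mod_act s).
Proof. by move=> a x y; apply/ffunP => T; rewrite !ffunE. Qed.

HB.instance Definition _ s :=
  GRing.isLinear.Build k tabloid_mod tabloid_mod _ (tabloid_mod_act s)
    (tabloid_mod_act_linear s).

Lemma tabloid_mod_act_vec s T :
  tabloid_mod_act s (tabloid_vec T) = tabloid_vec (tabloid_act s T).
Proof.
apply/ffunP => U; rewrite !ffunE; congr (_%:R); congr nat_of_bool.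
by rewrite -(can_eq (tabloid_actK s)) tabloid_actKV.
Qed.

Lemma tabloid_of_act s t :
  tabloid_of (filling_act s t) = tabloid_act s (tabloid_of t).
Proof.
apply/ffunP => i; rewrite !ffunE -imset_comp.
by apply: eq_imset => c; rewrite /= ffunE.
Qed.

Lemma column_stab_act s t p :
  ((p ^ s)%g \in column_stab (filling_act s t)) = (p \in column_stab t).
Proof.
rewrite !inE; apply: eq_forallb => c; apply: eq_existsb => c'.
by rewrite !ffunE permJ (inj_eq perm_inj).
Qed.

Lemma polytabloid_act s t :
  tabloid_mod_act s (polytabloid t) = polytabloid (filling_act s t).
Proof.
rewrite /polytabloid linear_sum [RHS](reindex_inj (conjg_inj s)) /=.
apply: eq_big => [p|p _]; first by rewrite column_stab_act.
rewrite linearZ_LR /= tabloid_mod_act_vec odd_permJ -tabloid_of_act.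
congr (_ *: tabloid_vec (tabloid_of _)).
by apply/ffunP => c; rewrite !ffunE permJ.
Qed.

Lemma specht_vs_act s x : x \in specht_vs -> tabloid_mod_act s x \in specht_vs.
Proof.
case/memv_sumP => y yP ->; rewrite linear_sum; apply: rpred_sum => t tP.
have /vlineP[a ->] := yP t tP; rewrite linearZ_LR /= polytabloid_act.
apply: rpredZ; apply: (subvP (sumv_sup (filling_act s t) _ (subvv _))).
  apply/injectiveP => c c'; rewrite !ffunE => /perm_inj.
  exact: (injectiveP _ tP).
exact: memv_line.
Qed.

Lemma vsval_specht_act s (x : specht) :
  vsval (specht_act s x) = tabloid_mod_act s (vsval x).
Proof. by rewrite vsprojK // specht_vs_act // subvsP. Qed.

End Specht.

Section Schur.
Variables (k : fieldType) (la : intpart) (V : lmodType k).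

Definition equivariant : {pred (specht k la -> tpow (sumn la) V)} := fun f =>
  `[< linear f /\ forall s x, f (specht_act s x) = tensor_perm s (f x) >].

Lemma equivariant_submod : GRing.submod_closed equivariant.
Proof.
split=> [|a f g /asboolP[flin fS] /asboolP[glin gS]]; apply/asboolP; split.
- by move=> b x y; rewrite /= scaler0 addr0.
- by move=> s x; rewrite /= linear0.
- move=> b x y; have afgE z : (a *: f + g) z = a *: f z + g z by [].
  by rewrite !afgE flin glin !scalerDr !scalerA [a * b]mulrC addrACA.
- by move=> s x; have afgE z : (a *: f + g) z = a *: f z + g z by []; rewrite !afgE fS gS linearP.
Qed.

HB.instance Definition _ := GRing.isSubmodClosed.Build k _ equivariant
  equivariant_submod.

Record schur := Schur {
  schur_fun :> specht k la -> tpow (sumn la) V;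
  schur_equivariant : schur_fun \in equivariant
}.

HB.instance Definition _ := [isSub for schur_fun].
HB.instance Definition _ := [Choice of schur by <:].
HB.instance Definition _ := [SubChoice_isSubLmodule of schur by <:].

End Schur.

Section SchurMap.
Variables (k : fieldType) (la : intpart) (V W : lmodType k).
Variable j : {linear V -> W}.

Lemma schur_map_subproof (f : schur la V) :
  tensor_map idfun j \o f \in @equivariant k la W.
Proof.
have jP : linear_for (idfun \; *:%R) j by exact: linearP.
have /asboolP[flin fS] := schur_equivariant f; apply/asboolP; split.
- by move=> a x y; rewrite /= flin (tensor_mapP jP).
- by move=> s x; rewrite /= fS (tensor_map_perm jP).
Qed.

Definition schur_map (f : schur la V) : schur la W :=
  Schur (schur_map_subproof f).

End SchurMap.

Record lspace (k : fieldType) (r : nat) (la : r.-tuple intpart) := LSpace {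
  lcarrier :> lmodType k;
  lform : forall i : 'I_r, {scalar schur (tnth la i) lcarrier}
}.

Definition pure (r : nat) (la : r.-tuple intpart) :=
  forall i : 'I_r, parts (tnth la i) <> [::].

Section Dimension.
Variables (k : fieldType) (V : lmodType k).

Definition is_basis (I : eqType) (b : I -> V) :=
  (forall (s : seq I) (c : I -> k), uniq s ->
     \sum_(i <- s) c i *: b i = 0 -> forall i, i \in s -> c i = 0) /\
  (forall v, exists (s : seq I) (c : I -> k), v = \sum_(i <- s) c i *: b i).

Definition has_dim (d : nat) := exists b : 'I_d -> V, is_basis b.
Definition finite_dim := exists d, has_dim d.
Definition countable_dim := exists b : nat -> V, is_basis b.

End Dimension.

Section Universal.
Variables (k : fieldType) (r : nat) (la : r.-tuple intpart).

Definition is_embedding (V W : lspace k la) (j : {linear V -> W}) :=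
  injective j /\ forall i (f : schur (tnth la i) V),
    lform W i (schur_map j f) = lform V i f.

Definition embeds (V W : lspace k la) :=
  exists j : {linear V -> W}, is_embedding j.

Definition universal (V : lspace k la) :=
  forall W : lspace k la, finite_dim W -> embeds W V.

Definition d_universal (d : nat) (V : lspace k la) :=
  forall W : lspace k la, has_dim W d -> embeds W V.

End Universal.

Section ExtScalars.
Variables (k k' : fieldType) (iota : {rmorphism k -> k'}) (V : lmodType k).

(* V (x)_k k' is presented as a k'-vector space: the generator << v >> stands *)
(* for v (x) 1, so that c *: << v >> is v (x) c.                              *)
Inductive ext_rel : {malg k'[V]} -> Prop :=
| ExtRel (a : k) (x y : V) :
    ext_rel (<< a *: x + y >> - (iota a *: << x >> + << y >>)).

Definition ext_scalars := quot_mod ext_rel.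
HB.instance Definition _ := GRing.Lmodule.on ext_scalars.

Definition ext_in (v : V) : ext_scalars := quot_mod_pi ext_rel << v >>.

Lemma ext_inP : linear_for (iota \; *:%R) ext_in.
Proof.
move=> a x y; rewrite /= -linearP; apply/quot_mod_piP.
exact/gen_submod_subset/ExtRel.
Qed.

End ExtScalars.

Section ExtLift.
Variables (k k' : fieldType) (iota : {rmorphism k -> k'}) (V : lmodType k).

Definition ext_lift (W : lmodType k') (h : V -> W) (q : ext_scalars iota V) : W :=
  quot_lift idfun h q.

Section Target.
Variables (W : lmodType k').

Lemma ext_lift_ext (h h' : V -> W) : h =1 h' -> ext_lift h =1 ext_lift h'.
Proof. by move=> hh' q; apply: eq_bigr => v _; rewrite hh'. Qed.

Lemma ext_liftDfun (a : k') (h h1 h2 : V -> W) q :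
  (forall v, h v = a *: h1 v + h2 v) ->
  ext_lift h q = a *: ext_lift h1 q + ext_lift h2 q.
Proof.
move=> hE; rewrite /ext_lift /quot_lift /free_lift scaler_sumr -big_split /=.
by apply: eq_bigr => v _; rewrite hE scalerDr !scalerA mulrC.
Qed.

Variable h : V -> W.
Hypothesis hP : linear_for (iota \; *:%R) h.

Lemma free_lift_ext_rel x : ext_rel iota x -> free_lift idfun h x = 0.
Proof.
case=> a u w; have lin := free_liftP idfun h.
rewrite addrC -scaleN1r !lin /= !free_liftU hP /=.
by rewrite scaleN1r addNr.
Qed.

Lemma ext_liftP : linear (ext_lift h).
Proof.
by move=> a p q; rewrite /ext_lift (quot_liftP free_lift_ext_rel).
Qed.

Lemma ext_lift_in v : ext_lift h (ext_in iota v) = h v.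
Proof.
by rewrite /ext_lift quot_lift_pi ?free_liftU //; exact: free_lift_ext_rel.
Qed.

End Target.

Lemma ext_ext (W : lmodType k') (f g : ext_scalars iota V -> W) :
  linear f -> linear g -> (forall v, f (ext_in iota v) = g (ext_in iota v)) ->
  f =1 g.
Proof.
move=> fP gP fg q; rewrite -[q]quot_mod_reprK; move: (generic_quotient.repr _) => x.
have zero h : linear h -> h (0 : ext_scalars iota V) = 0 :> W.
  move=> hP; have := hP (-1) 0 0; rewrite scaleN1r oppr0 addr0 /=.
  by rewrite scaleN1r addNr.
rewrite [x]monalgE; elim/big_rec: _ => [|v y _ IH].
  by rewrite linear0 !zero.
have -> : << x@_v *g v >> = x@_v *: << v >>.
  by apply/malgP => w; rewrite mcoeffZ !mcoeffU mulrnAr mulr1.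
by rewrite linearP fP gP IH fg.
Qed.

End ExtLift.

Section UpdTheory.
Variables (n : nat) (T : Type).
Implicit Types (v : {ffun 'I_n -> T}) (i j : 'I_n) (x y : T).

Lemma updC v i j x y : i != j -> upd (upd v i x) j y = upd (upd v j y) i x.
Proof.
move=> ij; apply/ffunP => l; rewrite !ffunE.
by case: (eqVneq l j) => // ->; rewrite eq_sym (negPf ij).
Qed.

Lemma upd_same v i x y : upd (upd v i x) i y = upd v i y.
Proof. by apply/ffunP => l; rewrite !ffunE; case: eqP. Qed.

Lemma upd_id v i : upd v i (v i) = v.
Proof. by apply/ffunP => l; rewrite !ffunE; case: eqP => [->|]. Qed.

End UpdTheory.

(* Base change of a multilinear form, one variable at a time.                 *)
Section MultilinearExt.
Variables (k k' : fieldType) (iota : {rmorphism k -> k'}) (V : lmodType k).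
Variables (n : nat) (m : {ffun 'I_n -> V} -> k').
Hypothesis mP : forall v i a x y,
  m (upd v i (a *: x + y)) = iota a * m (upd v i x) + m (upd v i y).

Local Notation V' := (ext_scalars iota V).

Fixpoint mext (s : seq 'I_n) (u : {ffun 'I_n -> V'}) (v : {ffun 'I_n -> V}) : k'^o :=
  if s is i :: s' then ext_lift (fun x => mext s' u (upd v i x)) (u i) else m v.

Lemma mext_v s u v j a x y : j \notin s ->
  mext s u (upd v j (a *: x + y)) =
  iota a *: mext s u (upd v j x) + mext s u (upd v j y).
Proof.
elim: s u v => [|i s IH] u v /=; first by rewrite mP.
rewrite inE negb_or => /andP[ji js]; apply: ext_liftDfun => z.
by rewrite !(updC _ _ _ ji) IH.
Qed.

Lemma mext_u s u v j p : j \notin s -> mext s (upd u j p) v = mext s u v.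
Proof.
elim: s v => [//|i s IH] v /=; rewrite inE negb_or => /andP[ji js].
rewrite ffunE eq_sym (negPf ji); apply: ext_lift_ext => x; exact: IH.
Qed.

Lemma mextP s u v j a p q : uniq s -> j \in s ->
  mext s (upd u j (a *: p + q)) v =
  a *: mext s (upd u j p) v + mext s (upd u j q) v.
Proof.
elim: s v => [//|i s IH] v /= /andP[is_ us]; rewrite inE.
have [-> _|ji /= js] := eqVneq j i.
  rewrite !ffunE eqxx.
  have E r : ext_lift (fun x => mext s (upd u i r) (upd v i x)) =1
             ext_lift (fun x => mext s u (upd v i x)).
    by apply: ext_lift_ext => x; rewrite mext_u.
  rewrite !E; apply: ext_liftP => b x y /=; exact: mext_v.
rewrite !ffunE eq_sym (negPf ji); apply: ext_liftDfun => x; exact: IH.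
Qed.

Lemma mext_in s w v : uniq s ->
  mext s [ffun i => ext_in iota (w i)] v =
  m [ffun i => if i \in s then w i else v i].
Proof.
elim: s v => [|i s IH] v /=.
  by move=> _; congr m; apply/ffunP => i; rewrite ffunE.
case/andP=> is_ us; rewrite ffunE ext_lift_in; last first.
  by move=> b x y; exact: mext_v.
rewrite IH //; congr m; apply/ffunP => j; rewrite !ffunE inE.
by case: (eqVneq j i) => [->|//]; rewrite (negPf is_).
Qed.

End MultilinearExt.

Section TensorExt.
Variables (k k' : fieldType) (iota : {rmorphism k -> k'}) (V : lmodType k).
Variable n : nat.
Local Notation V' := (ext_scalars iota V).
Local Notation tau := (tensor_map iota (n := n) (ext_in iota (V := V))).

Lemma tensor_ext (W : lmodType k') (f g : tpow n V' -> W) :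
  linear f -> linear g -> (forall t, f (tau t) = g (tau t)) -> f =1 g.
Proof.
move=> fP gP fg; apply: (@tpow_ext _ _ _ _ idfun) => // u.
have fgin (v : {ffun 'I_n -> V}) :
  f (ptensor [ffun i => ext_in iota (v i)]) =
  g (ptensor [ffun i => ext_in iota (v i)]).
  by have := fg (ptensor v); rewrite (tensor_mapE (@ext_inP _ _ iota V)).
suff H (s : seq 'I_n) : forall u : {ffun 'I_n -> V'}, (forall i, i \notin s -> exists v, u i = ext_in iota v) ->
    f (ptensor u) = g (ptensor u).
  by apply: (H (enum 'I_n)) => i; rewrite mem_enum.
elim: s => [|i s IH] {}u us.
  have /fin_all_exists[v uv] : forall i, exists v, u i = ext_in iota v.
    by move=> i; exact: us.
  have -> : u = [ffun i => ext_in iota ([ffun i => v i] i)].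
    by apply/ffunP => i; rewrite !ffunE uv.
  exact: fgin.
rewrite -(upd_id u i); move: (u i); apply: ext_ext => [a p q|a p q|v].
- by rewrite ptensor_multilinear fP.
- by rewrite ptensor_multilinear gP.
apply: IH => j js; rewrite ffunE; case: eqVneq => [_|ji]; first by exists v.
by apply: us; rewrite inE negb_or ji.
Qed.

(* A linear form on V^{(x) n} extends to one on (V (x)_k k')^{(x) n}.        *)
Lemma tensor_form_ext (phi : {scalar tpow n V}) :
  exists phi' : {scalar tpow n V'}, forall t, phi' (tau t) = iota (phi t).
Proof.
pose m (v : {ffun 'I_n -> V}) := iota (phi (ptensor v)).
have mP v i a x y :
    m (upd v i (a *: x + y)) = iota a * m (upd v i x) + m (upd v i y).
  by rewrite /m ptensor_multilinear linearP rmorphD rmorphM.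
pose g (u : {ffun 'I_n -> V'}) : k'^o := mext m (enum 'I_n) u 0.
have gP : multilinear idfun g.
  by move=> u i a p q; rewrite /g (mextP mP) ?enum_uniq ?mem_enum.
have lin : scalar (tensor_lift idfun g).
  by move=> a t u; rewrite (tensor_liftP gP).
pose L := GRing.isLinear.Build k' (tpow n V') k' _ (tensor_lift idfun g : tpow n V' -> k') lin.
pose phi' : {scalar tpow n V'} := HB.pack (tensor_lift idfun g : tpow n V' -> k') L.
exists phi' => t.
have extP := @ext_inP _ _ iota V.
apply: (@tpow_ext _ _ _ _ iota k'^o (fun t => phi' (tau t))
  (fun t => iota (phi t))) => [a x y|a x y|v].
- by rewrite (tensor_mapP extP) linearP.
- by rewrite linearP rmorphD rmorphM.
rewrite (tensor_mapE extP) /= tensor_lift_ptensor // /g (mext_in mP) ?enum_uniq //.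
by congr m; apply/ffunP => i; rewrite ffunE mem_enum.
Qed.

End TensorExt.

Section SpechtExt.
Variables (k k' : fieldType) (iota : {rmorphism k -> k'}) (la : intpart).

(* The canonical map from the Specht module over k to the one over k'.        *)
Definition tabloid_mod_ext (x : tabloid_mod k la) : tabloid_mod k' la :=
  [ffun T => iota (x T)].

Definition specht_ext (x : specht k la) : specht k' la :=
  vsproj (specht_vs k' la) (tabloid_mod_ext (vsval x)).

Lemma tabloid_mod_extP : linear_for (iota \; *:%R) tabloid_mod_ext.
Proof. by move=> a x y; apply/ffunP => T; rewrite !ffunE rmorphD rmorphM. Qed.

Lemma tabloid_mod_ext_sum I (s : seq I) P (F : I -> tabloid_mod k la) :
  tabloid_mod_ext (\sum_(i <- s | P i) F i) =
  \sum_(i <- s | P i) tabloid_mod_ext (F i).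
Proof.
apply/ffunP => T; rewrite ffunE !sum_ffunE rmorph_sum.
by apply: eq_bigr => i _; rewrite ffunE.
Qed.

Lemma polytabloid_ext t :
  tabloid_mod_ext (polytabloid k t) = polytabloid k' t.
Proof.
rewrite tabloid_mod_ext_sum; apply: eq_bigr => s _.
apply/ffunP => T; rewrite !ffunE.
rewrite -[_ *: _ in LHS]/(_ * _) -[_ *: _ in RHS]/(_ * _).
by rewrite rmorphM rmorph_sign rmorph_nat.
Qed.

Lemma tabloid_mod_ext_specht x :
  x \in specht_vs k la -> tabloid_mod_ext x \in specht_vs k' la.
Proof.
case/memv_sumP => y yP ->; rewrite tabloid_mod_ext_sum; apply: rpred_sum => t tP.
have /vlineP[a ->] := yP t tP.
have -> : tabloid_mod_ext (a *: polytabloid k t) = iota a *: polytabloid k' t.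
  by rewrite -polytabloid_ext; apply/ffunP => T; rewrite !ffunE rmorphM.
apply: rpredZ; apply: (subvP (sumv_sup t tP (subvv _))); exact: memv_line.
Qed.

Lemma vsval_specht_ext x : vsval (specht_ext x) = tabloid_mod_ext (vsval x).
Proof. by rewrite vsprojK // tabloid_mod_ext_specht // subvsP. Qed.

End SpechtExt.

Section BaseChange.
Variables (k k' : fieldType) (iota : {rmorphism k -> k'}) (la : intpart).
Variable V : lmodType k.

Local Notation V' := (ext_scalars iota V).
Local Notation tau := (tensor_map iota (n := sumn la) (ext_in iota (V := V))).

(* f' is the image of f under the canonical map from S_la(V) to S_la(V'),     *)
(* i.e., the k'-linear extension of f.                                        *)
Definition schur_ext (f : schur la V) (f' : schur la V') :=
  forall x, f' (specht_ext iota x) = tau (f x).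

(* Under the identification of S_la(V') with S_la(V) (x)_k k', w' is the form *)
(* deduced from w by extension of scalars. In characteristic 0, lemmas        *)
(* form_ext_exists and form_ext_unique show that there is exactly one.        *)
Definition is_form_ext (w : {scalar schur la V}) (w' : {scalar schur la V'}) :=
  forall f f', schur_ext f f' -> w' f' = iota (w f).

End BaseChange.

Section Average.
Variables (k : fieldType) (la : intpart) (V : lmodType k).
Local Notation n := (sumn la).

Lemma tensor_permM s s' (t : tpow n V) :
  tensor_perm (s * s')%g t = tensor_perm s' (tensor_perm s t).
Proof.
move: t; apply: (@tpow_ext _ _ _ _ idfun) => [a t u|a t u|v].
- by rewrite !linearP.
- by rewrite !linearP.
rewrite !tensor_permE; congr ptensor; apply/ffunP => i.
by rewrite !ffunE invMg permM.
Qed.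

Lemma tabloid_mod_actM s s' (x : tabloid_mod k la) :
  tabloid_mod_act (s * s')%g x = tabloid_mod_act s' (tabloid_mod_act s x).
Proof.
apply/ffunP => T; rewrite !ffunE; congr (x _); apply/ffunP => i.
rewrite !ffunE -imset_comp; apply: eq_imset => y /=.
by rewrite invMg permM.
Qed.

(* The average over the symmetric group of the map sending x to x_T *: t.     *)
Definition avg_fun (T : tabloid la) (t : tpow n V) (x : specht k la) : tpow n V :=
  (n`!%:R)^-1 *: \sum_(s : 'S_n)
    tabloid_mod_act s (vsval x) T *: tensor_perm (s^-1)%g t.

Lemma avg_subproof T t : avg_fun T t \in @equivariant k la V.
Proof.
apply/asboolP; split=> [a x y|r x].
  rewrite /avg_fun scalerA [a * _]mulrC -scalerA -scalerDr.
  congr (_ *: _); rewrite scaler_sumr -big_split /=; apply: eq_bigr => s _.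
  by rewrite !linearP !ffunE scalerDl scalerA.
rewrite /avg_fun [RHS]linearZ_LR [in RHS]linear_sum /=; congr (_ *: _).
rewrite [RHS](reindex_inj (mulgI r)) /=; apply: eq_bigr => s _.
rewrite linearZ_LR /= vsval_specht_act tabloid_mod_actM -tensor_permM.
by rewrite invMg mulgKV.
Qed.

Definition avg T t : schur la V := Schur (avg_subproof T t).

Lemma avg_is_linear T : linear (avg T).
Proof.
move=> a t u; apply/val_inj/funext => x.
rewrite -[RHS]/(a *: avg_fun T t x + avg_fun T u x) /= /avg_fun.
rewrite scalerA [a * _]mulrC -scalerA -scalerDr.
congr (_ *: _); rewrite scaler_sumr -big_split /=; apply: eq_bigr => s _.
by rewrite linearP scalerDr !scalerA [a * _]mulrC.
Qed.

HB.instance Definition _ T :=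
  GRing.isLinear.Build k (tpow n V) (schur la V) _ (avg T) (avg_is_linear T).

Lemma avg_sum (hk : (n`!%:R : k) != 0) (f : schur la V) :
  f = \sum_T avg T (f (vsproj (specht_vs k la) (tabloid_vec k T))).
Proof.
apply/val_inj/funext => x.
have sumE (s : seq (tabloid la)) (F : tabloid la -> schur la V) :
    schur_fun (\sum_(T <- s) F T) x = \sum_(T <- s) F T x.
  by elim/big_rec2: _ => [//|T u g _ <-].
rewrite [RHS]sumE /= /avg_fun -scaler_sumr exchange_big /=.
have /asboolP[flin fS] := schur_equivariant f.
pose fL : {linear specht k la -> tpow n V} :=
  HB.pack (schur_fun f) (GRing.isLinear.Build k _ _ _ (schur_fun f) flin).
have fsum (y : specht k la) : f y =
    \sum_T vsval y T *: f (vsproj (specht_vs k la) (tabloid_vec k T)).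
  rewrite -[in LHS](vsvalK y).
  have yE : vsval y = \sum_T vsval y T *: tabloid_vec k T.
    apply/ffunP => T; rewrite sum_ffunE (bigD1 T) //= !ffunE eqxx.
    rewrite big1 ?addr0 => [|U UT]; first by rewrite -[_ *: _]/(_ * _) mulr1.
    by rewrite !ffunE eq_sym (negPf UT) scaler0.
  rewrite [in LHS]yE linear_sum -[LHS]/(fL _) linear_sum; apply: eq_bigr => T _.
  by rewrite !linearZ_LR.
rewrite (eq_bigr (fun=> f x)) => [|s _].
  by rewrite sumr_const card_Sn -[f x *+ _]scaler_nat scalerA mulVf // scale1r.
rewrite -[RHS](_ : tensor_perm (s^-1)%g (f (specht_act s x)) = f x); last first.
  rewrite fS -tensor_permM mulgV.
  move: (f x); apply: (@tpow_ext _ _ _ _ idfun) => [a t u|//|v].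
    by rewrite linearP.
  by rewrite tensor_permE; congr ptensor; apply/ffunP => i; rewrite !ffunE invg1 perm1.
rewrite [in RHS]fsum linear_sum; apply: eq_bigr => T _.
by rewrite vsval_specht_act linearZ_LR.
Qed.

End Average.

Section FormExt.
Variables (k k' : fieldType) (iota : {rmorphism k -> k'}).
Hypothesis k_char0 : [pchar k] =i pred0.
Variables (la : intpart) (V : lmodType k).
Local Notation n := (sumn la).
Local Notation V' := (ext_scalars iota V).
Local Notation tau := (tensor_map iota (n := n) (ext_in iota (V := V))).

Let fact_neq0 : (n`!%:R : k) != 0.
Proof. by have /pcharf0P-> := k_char0; rewrite -lt0n fact_gt0. Qed.

Lemma schur_ext_avg T t : schur_ext (avg T t) (avg T (tau t)).
Proof.
have extP := @ext_inP _ _ iota V.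
have tauP := tensor_mapP (n := n) extP.
have tau0 : tau 0 = 0.
  by have := tauP (-1) 0 0; rewrite scaleN1r oppr0 addr0 /= rmorphN rmorph1 scaleN1r addNr.
have tauZ a u : tau (a *: u) = iota a *: tau u.
  by rewrite -[a *: u]addr0 tauP tau0 addr0.
have tauD u w : tau (u + w) = tau u + tau w.
  by rewrite -[u in LHS]scale1r tauP /= rmorph1 scale1r.
move=> x; rewrite /= /avg_fun tauZ fmorphV rmorph_nat; congr (_ *: _).
rewrite (big_morph tau tauD tau0); apply: eq_bigr => s _.
rewrite tauZ (tensor_map_perm extP); congr (_ *: _).
by rewrite vsval_specht_ext !ffunE.
Qed.

Lemma form_ext_exists (w : {scalar schur la V}) :
  exists w' : {scalar schur la V'}, is_form_ext w w'.
Proof.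
pose phi T : {scalar tpow n V} := w \o avg T.
have /fin_all_exists[phi' phiE] T := tensor_form_ext iota (phi T).
pose y T := vsproj (specht_vs k la) (tabloid_vec k T).
pose w' (f : schur la V') : k' := \sum_T phi' T (f (specht_ext iota (y T))).
have w'P : scalar w'.
  move=> a f g; rewrite /w' mulr_sumr -big_split /=; apply: eq_bigr => T _.
  by rewrite -linearP.
pose w'' : {scalar schur la V'} :=
  HB.pack w' (GRing.isLinear.Build k' _ k' _ w' w'P).
exists w'' => f f' ff'; rewrite /w'' /= /w'.
rewrite [in RHS](avg_sum fact_neq0 f) linear_sum rmorph_sum.
by apply: eq_bigr => T _; rewrite ff' phiE.
Qed.

Lemma form_ext_unique (w : {scalar schur la V}) (w1 w2 : {scalar schur la V'}) :
  is_form_ext w w1 -> is_form_ext w w2 -> w1 =1 w2.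
Proof.
move=> w1P w2P f.
have fact_neq0' : (n`!%:R : k') != 0.
  by rewrite -(rmorph_nat iota) fmorph_eq0.
rewrite (avg_sum fact_neq0' f) !linear_sum; apply: eq_bigr => T _.
move: (f _) => t.
apply: (@tensor_ext _ _ iota V n k'^o (fun t => w1 (avg T t))
  (fun t => w2 (avg T t))) => [a u v|a u v|u].
- by rewrite !linearP.
- by rewrite !linearP.
have e := schur_ext_avg T u.
by rewrite (w1P _ _ e) (w2P _ _ e).
Qed.

Definition form_ext (w : {scalar schur la V}) : {scalar schur la V'} :=
  projT1 (cid (form_ext_exists w)).

Lemma form_extP w : is_form_ext w (form_ext w).
Proof. by rewrite /form_ext; case: cid. Qed.

End FormExt.

(* The space V (x)_k k' with its induced la-structure.                        *)
Definition base_change (k k' : fieldType) (iota : {rmorphism k -> k'})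
    (k_char0 : [pchar k] =i pred0) (r : nat) (la : r.-tuple intpart)
    (V : lspace k la) : lspace k' la :=
  LSpace (fun i => form_ext iota k_char0 (lform V i)).

(* Main.v *)
(* In characteristic 0, averaging over the symmetric group turns a la-form on *)
(* W into a sum of multilinear forms on W evaluated at fixed generators of    *)
(* the Specht module, so it suffices to embed families of multilinear forms   *)
(* of positive degrees. Take coordinates x_j and z_(h,a), where h indexes the *)
(* forms and a the monomials of degree n = deg h in the x_j, and put on the   *)
(* space with these coordinates the forms                                     *)
(*   Phi_h(v_1, .., v_n) =                                                    *)
(*     \sum_a z_(h,a)(v_1) x_(a_2)(v_2) .. x_(a_n)(v_n).                      *)
(* A space W with coordinates x_j and forms with coefficients phi_(h,a)       *)
(* embeds through z_(h,a) = phi_(h,a) x_(a_1). Infinitely many x_j give (a),  *)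
(* and d of them give (b). The construction commutes with extension of        *)
(* scalars, so an embedding of the d-universal space over k into V extends to *)
(* one of the d-universal space over k' into the base change of V: this is    *)
(* (c).                                                                       *)

From HB Require Import structures.
Require Import Defs.
From mathcomp Require Import all_boot all_algebra.
From mathcomp Require Import boolp classical_sets functions cardinality.
From mathcomp Require Import finmap monalg.

Set Implicit Arguments.
Unset Strict Implicit.
Unset Printing Implicit Defensive.

Import GRing.Theory.
Local Open Scope ring_scope.

(** By [avg_sum], an element [f] of the Schur functor is the sum over tabloids [T] of averages of
    the tensors [f (y T)], so [form_decomp] turns each form of a space into linear forms [phi T] on
    a tensor power. A linear map that pulls back the [phi T] pulls back the form. [forms_embed]
    pulls back any finite family of linear forms on tensor powers of positive degree: the
    x-coordinates keep the map injective, and the z-coordinates, each entering one form linearly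
    through a single slot, are free to realize any coefficients. Purity makes the degrees positive,
    and [ulspace_universal] gives (a) and (b). For (c), the forms Phi_h have coefficients 0 and 1,
    so they are compatible with field extension ([utensor_map]), and [ulspace_base_change] carries
    an embedding over [k] to one over [k']. *)

Section Semilinear.
Variables (R S : nzRingType) (sigma : {rmorphism R -> S}).
Variables (V : lmodType R) (W : lmodType S) (f : V -> W).
Hypothesis fP : linear_for (sigma \; *:%R) f.

Lemma semilinear0 : f 0 = 0.
Proof.
have := fP (-1) 0 0; rewrite scaleN1r oppr0 addr0 /=.
by rewrite rmorphN rmorph1 scaleN1r addNr.
Qed.

Lemma semilinearZ a v : f (a *: v) = sigma a *: f v.
Proof. by rewrite -[a *: v]addr0 fP semilinear0 addr0. Qed.

Lemma semilinear_comb (I : Type) (s : seq I) (P : pred I) (c : I -> R) (b : I -> V) :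
  f (\sum_(i <- s | P i) c i *: b i) = \sum_(i <- s | P i) sigma (c i) *: f (b i).
Proof.
elim/big_rec2: _ => [|i x y _ <-]; first exact: semilinear0.
by rewrite fP.
Qed.

End Semilinear.

Definition spans (k : nzRingType) (V : lmodType k) (K : Type) (b : K -> V) :=
  forall v, exists (s : seq K) (c : K -> k), v = \sum_(i <- s) c i *: b i.

(** The induction is on a list [s] of slots whose entries are still arbitrary; each step expands one
    of them in the spanning family. *)
Lemma tpow_ext_span (k : fieldType) (n : nat) (V : lmodType k) (S : nzRingType)
    (sigma : {rmorphism k -> S}) (W : lmodType S) (f g : tpow n V -> W)
    (K : Type) (b : K -> V) :
  spans b ->
  linear_for (sigma \; *:%R) f -> linear_for (sigma \; *:%R) g ->
  (forall c : 'I_n -> K, f (ptensor [ffun i => b (c i)]) =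
     g (ptensor [ffun i => b (c i)])) -> f =1 g.
Proof.
move=> bspan fP gP fg; apply: (tpow_ext fP gP) => u.
suff H (s : seq 'I_n) : forall u : {ffun 'I_n -> V},
    (forall i, i \notin s -> exists c, u i = b c) ->
    f (ptensor u) = g (ptensor u).
  by apply: (H (enum 'I_n)) => i; rewrite mem_enum.
elim: s => [|i s IH] {}u us.
  have /fin_all_exists[c uc] : forall i, exists c, u i = b c.
    by move=> i; exact: us.
  have -> : u = [ffun i => b (c i)] by apply/ffunP => i; rewrite ffunE uc.
  exact: fg.
rewrite -(upd_id u i); have [t [c ->]] := bspan (u i).
have updP : linear_for (idfun \; *:%R) (fun x => ptensor (upd u i x)).
  by move=> a x y; rewrite ptensor_multilinear.
rewrite (semilinear_comb updP) (semilinear_comb fP) (semilinear_comb gP).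
apply: eq_bigr => l _; congr (_ *: _); apply: IH => j js.
rewrite ffunE; case: eqVneq => [_|ji]; first by exists l.
by apply: us; rewrite inE negb_or ji.
Qed.

(** * Free modules, bases and coordinates *)

Section FreeModule.
Variables (k : fieldType) (K : choiceType).

Lemma malgU_scale (a : k) (x : K) : << a *g x >> = a *: << x >>.
Proof. by apply/malgP => w; rewrite mcoeffZ !mcoeffU mulrnAr mulr1. Qed.

Lemma malg_comb (x : {malg k[K]}) : x = \sum_(i <- msupp x) x@_i *: << i >>.
Proof. by rewrite [LHS]monalgE; apply: eq_bigr => i _; rewrite malgU_scale. Qed.

Lemma mcoeff_comb (s : seq K) (c : K -> k) i : uniq s ->
  (\sum_(j <- s) c j *: << j >>)@_i = if i \in s then c i else 0 :> k.
Proof.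
move=> us; rewrite raddf_sum /=.
rewrite (eq_bigr (fun j => if j == i then c i else 0)) => [|j _]; last first.
  by rewrite mcoeffZ mcoeffU; case: eqVneq => [->|]; rewrite ?mulr1 ?mulr0.
rewrite -big_mkcond /=; case: ifP => [si|/negP si].
  by rewrite -big_filter filter_pred1_uniq ?big_seq1.
by rewrite big1_seq // => j /andP[/eqP-> /si].
Qed.

Lemma malg_basis : is_basis (fun i : K => << i >> : {malg k[K]}).
Proof.
split=> [s c us s0 i si|v].
  by have := mcoeff_comb c i us; rewrite s0 mcoeff0 si.
by exists (msupp v), (fun i => v@_i); exact: malg_comb.
Qed.

Lemma is_basis_reindex (V : lmodType k) (I J : eqType) (b : I -> V) (h : J -> I) :
  bijective h -> is_basis b -> is_basis (b \o h).
Proof.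
move=> [g gK hK] [bfree bspan]; split=> [s c us s0 j js|v].
  have := bfree (map h s) (c \o g); rewrite map_inj_uniq ?us; last exact: can_inj gK.
  rewrite big_map (eq_bigr (fun i => c i *: b (h i))) => [|i _]; last first.
    by rewrite /= gK.
  by move=> /(_ isT s0 (h j)); rewrite /= gK; apply; exact: map_f.
have [s [c ->]] := bspan v; exists (map g s), (c \o h).
by rewrite big_map; apply: eq_bigr => i _; rewrite /= hK.
Qed.

Variables (V : lmodType k) (b : K -> V).

Lemma free_lift_inj : is_basis b -> injective (free_lift idfun b).
Proof.
move=> [bfree _] x y /eqP; rewrite -subr_eq0 => /eqP xy.
have {xy} : free_lift idfun b (x - y) = 0.
  by rewrite addrC -scaleN1r (free_liftP idfun b) /= scaleN1r addrC.
move/(bfree _ _ (fset_uniq _)) => xy0; apply/eqP; rewrite -subr_eq0; apply/eqP/malgP => i.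
rewrite mcoeff0; have [isup|isup] := boolP (i \in msupp (x - y)).
  exact: (xy0 i isup).
exact: mcoeff_outdom.
Qed.

Lemma free_lift_surj : spans b -> forall v, exists x, free_lift idfun b x = v.
Proof.
move=> bspan v; have [s [c ->]] := bspan v.
exists (\sum_(i <- s) c i *: << i >>).
rewrite (semilinear_comb (free_liftP idfun b)).
by apply: eq_bigr => i _; rewrite free_liftU.
Qed.

Lemma basis_coord : is_basis b -> exists g : {linear V -> {malg k[K]}},
  cancel g (free_lift idfun b) /\ forall i, g (b i) = << i >>.
Proof.
move=> bP; have /choice[g gK] := free_lift_surj (proj2 bP).
have binj := free_lift_inj bP.
have glin : linear g.
  by move=> a u v; apply: binj; rewrite (free_liftP idfun b) !gK.
pose gL : {linear V -> {malg k[K]}} :=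
  HB.pack g (GRing.isLinear.Build k V _ _ g glin).
exists gL; split=> // i.
by apply: binj; rewrite gK free_liftU.
Qed.

End FreeModule.

Lemma malg_comb_fin (k : fieldType) (K : finType) (x : {malg k[K]}) :
  x = \sum_i x@_i *: << i >>.
Proof.
apply/malgP => i; rewrite -[index_enum _]enumT mcoeff_comb ?enum_uniq //.
by rewrite mem_enum.
Qed.

(** * Universal families of multilinear forms *)

Section UniversalForms.
Variables (H : finType) (deg : H -> nat) (t0 : forall h, 'I_(deg h)).

(* The index set of the coordinates z_(h,a).                                  *)
Definition mons (J : Type) := {h : H & {ffun 'I_(deg h) -> J}}.

Definition mons_map (I J : Type) (u : I -> J) (z : mons I) : mons J :=
  Tagged (fun h => {ffun 'I_(deg h) -> J}) [ffun t => u (tagged z t)].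

Section Form.
Variables (k : fieldType) (J : choiceType).

Definition ucoords := (J + mons J)%type.
HB.instance Definition _ := Choice.on ucoords.

Definition ucarrier := {malg k[ucoords]}.
HB.instance Definition _ := GRing.Lmodule.on ucarrier.

(** The factor that multiplies the coordinate [z] of [v (t0 h)] in Phi_h; the default 0 of [untag]
    discards the z-coordinates of other forms. For infinite [J] the sum over monomials thus becomes
    a finite sum over the support of [v (t0 h)]. *)
Definition uweight h (v : {ffun 'I_(deg h) -> ucarrier}) (z : ucoords) : k^o :=
  if z is inr z' then
    untag (T_ := fun h => {ffun 'I_(deg h) -> J}) 0 (i := h)
      (fun a => \prod_(t | t != t0 h) (v t)@_(inl (a t))) z'
  else 0.

Lemma uweight_tag h (v : {ffun 'I_(deg h) -> ucarrier}) (a : {ffun 'I_(deg h) -> J}) :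
  uweight v (inr (Tagged _ a)) = \prod_(t | t != t0 h) (v t)@_(inl (a t)).
Proof. exact: (untagE _ _ (u := Tagged _ a) (erefl h)). Qed.

Definition uform h (v : {ffun 'I_(deg h) -> ucarrier}) : k^o :=
  free_lift idfun (uweight v) (v (t0 h)).

(** The weights ignore slot [t0 h], and every other slot contributes exactly one factor to each
    product. *)
Lemma uform_multilinear h : multilinear idfun (@uform h).
Proof.
move=> v i a x y; rewrite /uform.
have [->|it] := eqVneq i (t0 h).
  have wE z : uweight (upd v (t0 h) z) = uweight v.
    apply/funext => -[//|[h' b]]; rewrite /uweight /untag; case: eqP => // e.
    by apply: eq_bigr => t tt0; rewrite ffunE (negPf tt0).
  by rewrite !wE !ffunE eqxx free_liftP.
have vE z : upd v i z (t0 h) = v (t0 h) by rewrite ffunE eq_sym (negPf it).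
rewrite !vE /free_lift scaler_sumr -big_split /=; apply: eq_bigr => z _.
rewrite scalerA [a * _]mulrC -scalerA -scalerDr; congr (_ *: _).
case: z => [j|z]; rewrite /uweight; first by rewrite scaler0 addr0.
rewrite /untag; case: eqP => [e|_]; last by rewrite scaler0 addr0.
rewrite !(bigD1 i it) /= !ffunE eqxx mcoeffD mcoeffZ mulrDl -mulrA.
congr (_ * (_ * _) + _ * _); apply: eq_bigr => t /andP[_ ti];
  by rewrite !ffunE (negPf ti).
Qed.

Definition utensor h : tpow (deg h) ucarrier -> k^o := tensor_lift idfun (@uform h).

Lemma utensorP h : scalar (@utensor h).
Proof. by move=> a s t; rewrite /utensor (tensor_liftP (@uform_multilinear h)). Qed.

Lemma utensorE h v : utensor (ptensor v) = uform (h := h) v.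
Proof. exact/tensor_lift_ptensor/uform_multilinear. Qed.

End Form.

Arguments ucarrier : clear implicits.
Arguments utensor {k J h}.

Section FormMap.
Variables (k k' : fieldType) (sigma : {rmorphism k -> k'}) (J : choiceType).

Definition ucarrier_map : ucarrier k J -> ucarrier k' J :=
  free_lift sigma (fun z => << z >>).

Lemma ucarrier_mapP : linear_for (sigma \; *:%R) ucarrier_map.
Proof. exact: free_liftP. Qed.

(** On tensors of basis vectors Phi_h takes only the values 0 and 1, which [sigma] preserves. *)
Lemma utensor_map h (t : tpow (deg h) (ucarrier k J)) :
  utensor (tensor_map sigma ucarrier_map t) = sigma (utensor t).
Proof.
move: t; apply: (@tpow_ext_span _ _ _ _ sigma k'^o
  (fun t => utensor (tensor_map sigma ucarrier_map t))
  (fun t => sigma (utensor t)) _ _ (proj2 (malg_basis k (ucoords J)))).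
- by move=> a x y; rewrite (tensor_mapP ucarrier_mapP) utensorP.
- by move=> a x y; rewrite utensorP rmorphD rmorphM.
move=> c; rewrite (tensor_mapE ucarrier_mapP) !utensorE /uform.
rewrite !ffunE /ucarrier_map !free_liftU /uweight.
case: (c (t0 h)) => [_|z]; first by rewrite rmorph0.
rewrite /untag; case: eqP => [e|_]; last by rewrite rmorph0.
rewrite rmorph_prod; apply: eq_bigr => t _.
by rewrite !ffunE free_liftU !mcoeffU rmorphMn rmorph1.
Qed.

End FormMap.

Section Embed.
Variables (k : fieldType) (J : choiceType) (d : nat) (u : 'I_d -> J).
Hypothesis u_inj : injective u.
Variable cf : mons 'I_d -> k.

(* The image of the l-th basis vector of W when cf z is the coefficient of    *)
(* the monomial z.                                                            *)
Definition uvec (l : 'I_d) : ucarrier k J :=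
  1 *: << inl (u l) >> +
  \sum_(z : mons 'I_d | tagged z (t0 (tag z)) == l) cf z *: << inr (mons_map u z) >>.

Lemma uvec_inl l l' : (uvec l)@_(inl (u l')) = (l == l')%:R.
Proof.
rewrite /uvec scale1r mcoeffD mcoeffU raddf_sum big1 ?addr0 => [|z _].
  by rewrite (inj_eq (@inl_inj _ _)) (inj_eq u_inj).
by rewrite /= mcoeffZ mcoeffU mulr0.
Qed.

(** The x-coordinates of the [uvec l] are Kronecker deltas, so among the z-coordinates in slot
    [t0 h] only the one of the monomial [c] survives. *)
Lemma uform_uvec h (c : {ffun 'I_(deg h) -> 'I_d}) :
  uform [ffun t => uvec (c t)] = cf (Tagged _ c).
Proof.
rewrite /uform ffunE (free_liftP idfun) (semilinear_comb (free_liftP idfun _)).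
rewrite free_liftU /= scaler0 add0r.
rewrite (bigD1 (Tagged _ c)) //= free_liftU uweight_tag.
rewrite big1 => [|t _]; last by rewrite !ffunE uvec_inl eqxx.
rewrite big1 ?addr0 => [|[h' a]]; first exact: mulr1.
move=> /andP[/= ac0 ac]; rewrite free_liftU.
have [e|ne] := eqVneq h' h; last first.
  by rewrite /uweight untag_dflt // scaler0.
subst h'; rewrite uweight_tag.
have [t act] : exists t, a t != c t.
  apply/existsP; apply: contraNT ac; rewrite negb_exists => /forallP ac.
  by apply/eqP; congr Tagged; apply/ffunP => t; have /negPn/eqP := ac t.
(* The sum defining [uvec (c (t0 h))] only has [a] agreeing with [c] at [t0 h], so the disagreement
   lies in a slot that contributes a vanishing factor. *)
have tt0 : t != t0 h by apply: contraNneq act => ->.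
rewrite (bigD1 t) //= !ffunE uvec_inl eq_sym (negPf act) mul0r.
exact: scaler0.
Qed.

End Embed.

Lemma forms_embed (k : fieldType) (J : choiceType) (d : nat) (u : 'I_d -> J)
    (W : lmodType k) (b : 'I_d -> W) (phi : forall h, {scalar tpow (deg h) W}) :
  injective u -> is_basis b ->
  exists j : {linear W -> ucarrier k J}, injective j /\
    forall h t, utensor (tensor_map idfun j t) = phi h t.
Proof.
move=> u_inj bP; have [g [gK gb]] := basis_coord bP.
(* The coefficients of the forms in the basis [b]; with this choice [uform_uvec] says that [j] is
   right on tensors of basis vectors. *)
pose cf (z : mons 'I_d) := phi (tag z) (ptensor [ffun t => b (tagged z t)]).
have jlin : linear (free_lift idfun (uvec u cf) \o g).
  by move=> a x y; rewrite /= linearP (free_liftP idfun).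
pose j : {linear W -> ucarrier k J} :=
  HB.pack (free_lift idfun (uvec u cf) \o g) (GRing.isLinear.Build k _ _ _ _ jlin).
have jP : linear_for (idfun \; *:%R) j by exact: linearP.
exists j; split=> [w w' jw|h t].
  apply: (can_inj gK); apply/malgP => l.
  have jE x : (j x)@_(inl (u l)) = (g x)@_l.
    rewrite [in RHS](malg_comb (g x)) !raddf_sum; apply: eq_bigr => v _.
    by rewrite /= !mcoeffZ uvec_inl // mcoeffU.
  by rewrite -!jE jw.
move: t; apply: (@tpow_ext_span _ _ _ _ idfun k^o
  (fun t => utensor (tensor_map idfun j t)) (phi h) _ _ (proj2 bP)).
- by move=> a x y; rewrite (tensor_mapP jP) utensorP.
- by move=> a x y; rewrite linearP.
move=> c; rewrite (tensor_mapE jP) utensorE.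
have := uform_uvec u_inj cf [ffun t => c t].
rewrite /cf /=.
have -> : [ffun t => uvec u cf ([ffun t => c t] t)] =
          [ffun i => j ([ffun i => b (c i)] i)].
  by apply/ffunP => t; rewrite !ffunE /= gb free_liftU.
move=> ->; congr (phi h (ptensor _)); apply/ffunP => t; by rewrite !ffunE.
Qed.

End UniversalForms.

(** * Forms on Schur functors as sums of forms on tensor powers *)

Lemma form_decomp (k : fieldType) (la : intpart) (W : lmodType k)
    (y : tabloid la -> specht k la) (w : {scalar schur la W}) :
  ((sumn la)`!%:R : k) != 0 ->
  (forall x, exists c : tabloid la -> k, x = \sum_S c S *: y S) ->
  exists phi : tabloid la -> {scalar tpow (sumn la) W},
    forall f, w f = \sum_S phi S (f (y S)).
Proof.
move=> fact_neq0 yspan.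
have /fin_all_exists[c cE] T := yspan (vsproj (specht_vs k la) (tabloid_vec k T)).
(* [avg_sum] evaluates [f] at projected tabloid vectors; expanding these in the generators [y S] and
   collecting the terms in [f (y S)] gives [phi S]. *)
pose phi S t := \sum_T c T S * w (avg T t).
have phiP S : scalar (phi S).
  move=> a t t'; rewrite /phi mulr_sumr -big_split /=; apply: eq_bigr => T _.
  by rewrite !linearP mulrDr mulrCA.
pose phiL S : {scalar tpow (sumn la) W} :=
  HB.pack (phi S) (GRing.isLinear.Build k _ k _ (phi S) (phiP S)).
exists phiL => f; rewrite [in LHS](avg_sum fact_neq0 f) linear_sum.
rewrite [RHS]exchange_big /=; apply: eq_bigr => T _.
have /asboolP[flin _] := schur_equivariant f.
have fP : linear_for (idfun \; *:%R) f by exact: flin.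
rewrite cE (semilinear_comb fP) !linear_sum; apply: eq_bigr => S _.
by rewrite !linearZ_LR.
Qed.

Lemma sumn_intpart_gt0 (la : intpart) : parts la <> [::] -> (0 < sumn la)%N.
Proof.
case: la => [[//|[|m] s] /= la_ok] _; last by rewrite addSn.
by case/andP: la_ok.
Qed.

Section SpechtSpan.
Variables (k : fieldType) (la : intpart).

Definition specht_proj (T : tabloid la) : specht k la :=
  vsproj (specht_vs k la) (tabloid_vec k T).

Lemma specht_projE (x : specht k la) : x = \sum_T (vsval x T : k) *: specht_proj T.
Proof.
rewrite -[LHS]vsvalK.
have {1}-> : vsval x = \sum_T vsval x T *: tabloid_vec k T.
  apply/ffunP => T; rewrite sum_ffunE (bigD1 T) //= !ffunE eqxx.
  rewrite big1 ?addr0 => [|U UT]; first by rewrite -[_ *: _]/(_ * _) mulr1.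
  by rewrite !ffunE eq_sym (negPf UT) scaler0.
by rewrite linear_sum; apply: eq_bigr => T _; rewrite linearZ_LR.
Qed.

Variables (k' : fieldType) (iota : {rmorphism k -> k'}).

Lemma specht_extP : linear_for (iota \; *:%R) (@specht_ext k k' iota la).
Proof.
move=> a x y; apply: (can_inj (@vsvalK _ _ (specht_vs k' la))).
rewrite vsval_specht_ext [RHS](linearP vsval) /= !vsval_specht_ext.
by rewrite -tabloid_mod_extP.
Qed.

(** Polytabloids span over [k'] and are images of polytabloids over [k], which are combinations of
    the [specht_proj T]. *)
Lemma specht_ext_span (x : specht k' la) :
  exists c : tabloid la -> k', x = \sum_T c T *: specht_ext iota (specht_proj T).
Proof.
suff [c xE] : exists c : tabloid la -> k',
    vsval x = \sum_T c T *: vsval (specht_ext iota (specht_proj T)).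
  exists c; apply/val_inj; rewrite [LHS]xE [RHS](linear_sum vsval).
  by apply: eq_bigr => T _; rewrite linearZ_LR.
have : vsval x \in specht_vs k' la by exact: subvsP.
case/memv_sumP => z zP ->.
have /fin_all_exists[c cE] (t : filling la) : exists c : tabloid la -> k', injectiveb t ->
    z t = \sum_T c T *: vsval (specht_ext iota (specht_proj T)).
  have [tP|tN] := boolP (injectiveb t); last by exists (fun=> 0).
  have /vlineP[a ->] := zP t tP.
  have pt : polytabloid k t \in specht_vs k la.
    apply: (subvP (sumv_sup t tP (subvv _))); exact: memv_line.
  pose p : specht k la := vsproj _ (polytabloid k t).
  exists (fun T => a * iota (vsval p T)) => _.
  rewrite -(polytabloid_ext iota) -[polytabloid k t](vsprojK pt) -/p.
  rewrite -vsval_specht_ext [in LHS](specht_projE p).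
  rewrite (semilinear_comb specht_extP) linear_sum scaler_sumr.
  by apply: eq_bigr => T _; rewrite linearZ_LR scalerA mulrC.
exists (fun T => \sum_(t : filling la | injectiveb t) c t T).
rewrite (eq_bigr _ cE) exchange_big /=; apply: eq_bigr => T _.
by rewrite scaler_suml.
Qed.

End SpechtSpan.

(** * The universal spaces *)

Section UniversalSpace.
Variables (r : nat) (la : r.-tuple intpart).
Hypothesis la_pure : pure la.

(* A la-form is a sum over tabloids T of n-linear forms applied to the values *)
(* at the generators y i T of the Specht module.                              *)
Definition form_index := {i : 'I_r & tabloid (tnth la i)}.
HB.instance Definition _ := Finite.on form_index.

Definition form_deg (h : form_index) := sumn (tnth la (tag h)).
Definition form_pos (h : form_index) : 'I_(form_deg h) :=
  Ordinal (sumn_intpart_gt0 (@la_pure (tag h))).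

Section Space.
Variables (k : fieldType) (J : choiceType).
Variable y : forall i, tabloid (tnth la i) -> specht k (tnth la i).

Local Notation U := (ucarrier form_deg k J).

(** The generators [y] are a parameter so that over an extension field they can be the images of
    generators chosen over [k]. *)
Definition ulform_fun i (f : schur (tnth la i) U) : k :=
  \sum_T utensor form_pos (h := Tagged (fun i => tabloid (tnth la i)) T) (f (y T)).

Lemma ulform_linear i : scalar (@ulform_fun i).
Proof.
move=> a f g; rewrite /ulform_fun mulr_sumr -big_split /=.
by apply: eq_bigr => T _; rewrite -utensorP.
Qed.

HB.instance Definition _ i :=
  GRing.isLinear.Build k (schur (tnth la i) U) k _ (@ulform_fun i) (@ulform_linear i).

Definition ulspace : lspace k la := @LSpace k r la U (fun i => @ulform_fun i).

Lemma ulspace_universal d (u : 'I_d -> J) :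
  injective u -> (forall i, ((sumn (tnth la i))`!%:R : k) != 0) ->
  (forall i (x : specht k (tnth la i)), exists c : tabloid (tnth la i) -> k,
     x = \sum_T c T *: y T) ->
  d_universal d ulspace.
Proof.
move=> u_inj fact_neq0 yspan W [b bP].
have phiE i : exists phi : tabloid (tnth la i) -> {scalar tpow (sumn (tnth la i)) W},
    forall f, lform W i f = \sum_S phi S (f (y S)).
  by apply: form_decomp; [exact: fact_neq0|exact: yspan].
pose phi i := projT1 (cid (phiE i)).
have phiP i f : lform W i f = \sum_S phi i S (f (y S)).
  by rewrite /phi; case: cid.
have [j [j_inj jE]] :=
  forms_embed form_pos (fun h : form_index => phi (tag h) (tagged h)) u_inj bP.
exists j; split=> // i f; rewrite phiP; apply: eq_bigr => T _.
exact: (jE (Tagged (fun i => tabloid (tnth la i)) T)).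
Qed.

End Space.
End UniversalSpace.

(** * Averages, embeddings and extension of scalars *)

Section SemilinearAvg.
Variables (k k' : fieldType) (sigma : {rmorphism k -> k'}).
Variables (V : lmodType k) (W : lmodType k') (j : V -> W).
Hypothesis jP : linear_for (sigma \; *:%R) j.

(** Semilinearity lets this serve both linear maps ([schur_map_avg]) and the coefficient extension
    [ucarrier_map]. *)
Lemma avg_tensor_map (la : intpart) (T : tabloid la) (t : tpow (sumn la) V)
    (x : specht k la) (x' : specht k' la) :
  vsval x' = tabloid_mod_ext sigma (vsval x) ->
  avg T (tensor_map sigma j t) x' = tensor_map sigma j (avg T t x).
Proof.
move=> x'E; have tmP := tensor_mapP (n := sumn la) jP.
rewrite /= /avg_fun (semilinearZ tmP) fmorphV rmorph_nat; congr (_ *: _).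
rewrite (semilinear_comb tmP); apply: eq_bigr => s _.
by rewrite (tensor_map_perm jP) x'E !ffunE.
Qed.

End SemilinearAvg.

Lemma schur_map_avg (k : fieldType) (V W : lmodType k) (j : {linear V -> W})
    (la : intpart) (T : tabloid la) (t : tpow (sumn la) V) :
  schur_map j (avg T t) = avg T (tensor_map idfun j t).
Proof.
apply/val_inj/funext => x; apply/esym.
apply: (@avg_tensor_map _ _ idfun); first exact: linearP.
by apply/ffunP => U; rewrite ffunE.
Qed.

Lemma embeds_trans (k : fieldType) (r : nat) (la : r.-tuple intpart)
    (U V W : lspace k la) : embeds U V -> embeds V W -> embeds U W.
Proof.
move=> [i [i_inj iP]] [j [j_inj jP]].
exists (j \o i : {linear U -> W}); split; first exact: inj_comp.
move=> l f; rewrite -iP -jP; congr (lform W l _); apply/val_inj/funext => x /=.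
have jiP : linear_for (idfun \; *:%R) (j \o i) by exact: linearP.
have ilin : linear_for (idfun \; *:%R) i by exact: linearP.
have jlin : linear_for (idfun \; *:%R) j by exact: linearP.
move: (f x); apply: (@tpow_ext _ _ _ _ idfun); first exact: tensor_mapP.
  by move=> a t t'; rewrite (tensor_mapP ilin) (tensor_mapP jlin).
move=> v; rewrite (tensor_mapE jiP) (tensor_mapE ilin) (tensor_mapE jlin).
by congr ptensor; apply/ffunP => t; rewrite !ffunE.
Qed.

Section BaseChangeEmbedding.
Variables (k k' : fieldType) (iota : {rmorphism k -> k'}).

(** In coordinates the family is a matrix with finitely many columns, and row-freeness survives a
    field extension. The coordinate functions extend to [ext_scalars] as [rho]. *)
Lemma ext_in_free (K : finType) (V : lmodType k) (v : K -> V) :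
  countable_dim V -> injective (free_lift idfun v) ->
  injective (free_lift idfun (fun i => ext_in iota (v i))).
Proof.
move=> [b bP] v_inj; have [g [gK _]] := basis_coord bP.
have vP := free_liftP idfun v; have fP := free_liftP idfun (fun i => ext_in iota (v i)).
have rhoP l : linear_for (iota \; *:%R) (fun x => iota (g x)@_l : k'^o).
  by move=> a x y; rewrite linearP mcoeffD mcoeffZ rmorphD rmorphM.
pose rho l := ext_lift (iota := iota) (fun x => iota (g x)@_l : k'^o).
(* All coordinates of index at least [N] vanish on the whole finite family. *)
pose N := (\max_i \max_(l <- msupp (g (v i))) l.+1)%N.
have gN i l : (N <= l)%N -> (g (v i))@_l = 0.
  move=> Nl; apply: mcoeff_outdom; apply: contraTN Nl => il; rewrite -ltnNge.
  apply: leq_trans (leq_bigmax i).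
  exact: (leq_bigmax_seq (F := fun l => l.+1) l il isT).
pose M : 'M[k]_(#|K|, N) := \matrix_(i, l) (g (v (enum_val i)))@_(val l).
have Mfree : row_free M.
  rewrite -kermx_eq0; apply/rowV0P => a /sub_kermxP aM.
  pose x : {malg k[K]} := \sum_i a 0 (enum_rank i) *: << i >>.
  have xE : free_lift idfun v x = \sum_i a 0 (enum_rank i) *: v i.
    by rewrite (semilinear_comb vP); apply: eq_bigr => i _; rewrite free_liftU.
  have x0 : x = 0.
    apply: v_inj; rewrite (semilinear0 vP) xE; apply: (can_inj gK).
    rewrite linear0; apply/malgP => l; rewrite mcoeff0 linear_sum raddf_sum /=.
    have [lN|Nl] := ltnP l N; last first.
      by rewrite big1 // => i _; rewrite linearZ_LR mcoeffZ gN ?mulr0.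
    have := congr1 (fun A : 'rV_N => A 0 (Ordinal lN)) aM.
    rewrite !mxE => aM0; rewrite -[RHS]aM0.
    rewrite (reindex _ (onW_bij _ (@enum_val_bij K))) /=; apply: eq_bigr => i _.
    by rewrite enum_valK linearZ_LR mcoeffZ mxE.
  apply/rowP => i; rewrite mxE.
  have := congr1 (mcoeff (enum_val i)) x0; rewrite mcoeff0 => <-.
  by rewrite /x -[index_enum _]enumT mcoeff_comb ?enum_uniq // mem_enum enum_valK.
move=> x y /eqP; rewrite -subr_eq0 => /eqP xy; apply/eqP; rewrite -subr_eq0; apply/eqP.
have {xy} : free_lift idfun (fun i => ext_in iota (v i)) (x - y) = 0.
  by rewrite addrC -scaleN1r fP /= scaleN1r addrC.
move: (x - y) => {x y} z z0; pose a : 'rV[k']_#|K| := \row_i z@_(enum_val i).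
have : a *m map_mx iota M = 0.
  apply/rowP => l; rewrite !mxE.
  have := congr1 (rho l) z0.
  have rhol : linear_for (idfun \; *:%R) (rho l) by exact: ext_liftP.
  rewrite (semilinear0 rhol) [z in free_lift _ _ z]malg_comb_fin.
  rewrite (semilinear_comb fP) (semilinear_comb rhol) => zl0; rewrite -[RHS]zl0.
  rewrite [RHS](reindex _ (onW_bij _ (@enum_val_bij K))) /=; apply: eq_bigr => i _.
  by rewrite !mxE free_liftU /rho (ext_lift_in (rhoP _)).
rewrite -[RHS](mul0mx _ (map_mx iota M)) => /row_free_inj.
rewrite row_free_map => /(_ Mfree) a0; rewrite [z]malg_comb_fin big1 // => i _.
have := congr1 (fun A : 'rV_#|K| => A 0 (enum_rank i)) a0.
by rewrite !mxE enum_rankK => ->; rewrite scale0r.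
Qed.

Variables (r : nat) (la : r.-tuple intpart) (la_pure : pure la).
Variable k_char0 : [pchar k] =i pred0.
Variables (J : finType) (y : forall i, tabloid (tnth la i) -> specht k (tnth la i)).

Lemma ulspace_base_change (V : lspace k la) :
  countable_dim V -> embeds (ulspace la_pure J y) V ->
  embeds (ulspace la_pure J (fun i T => specht_ext iota (y T)))
    (base_change iota k_char0 V).
Proof.
move=> Vcount [j [j_inj jE]].
have jP : linear_for (idfun \; *:%R) j by exact: linearP.
pose v (z : ucoords (@form_deg r la) J) : V := j << z >>.
have vE : free_lift idfun v =1 j.
  move=> x; rewrite [in RHS](malg_comb x) (semilinear_comb jP).
  exact: eq_bigr.
pose w z := ext_in iota (v z).
pose j' : {linear ucarrier (@form_deg r la) k' J -> ext_scalars iota V} :=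
  HB.pack (free_lift idfun w)
    (GRing.isLinear.Build k' _ _ _ (free_lift idfun w) (free_liftP idfun w)).
have j'P : linear_for (idfun \; *:%R) j' by exact: linearP.
exists j'; split; first by apply: ext_in_free => // x x'; rewrite !vE; exact: j_inj.
move=> i f.
have fact_neq0 : ((sumn (tnth la i))`!%:R : k') != 0.
  rewrite -(rmorph_nat iota) fmorph_eq0.
  by have /pcharf0P-> := k_char0; rewrite -lt0n fact_gt0.
(* It suffices to compare the forms on averages of tensors. These are linear in the tensor, so
   tensors of basis vectors suffice, and those come from [k], where [jE] applies. *)
rewrite (avg_sum fact_neq0 (schur_map j' f)) [in RHS](avg_sum fact_neq0 f) !linear_sum.
apply: eq_bigr => T _ /=; move: (f _) => {f} t; move: t.
apply: (@tpow_ext_span _ _ _ _ idfun k'^o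
  (fun t => form_ext iota k_char0 (lform V i) (avg T (tensor_map idfun j' t)))
  (fun t => ulform_fun la_pure (fun i T => specht_ext iota (y T)) (avg T t))
  _ _ (proj2 (malg_basis k' (ucoords (@form_deg r la) J)))).
- by move=> a t t'; rewrite (tensor_mapP j'P) !linearP.
- by move=> a t t'; rewrite !linearP.
move=> c; pose t : tpow _ (ucarrier (@form_deg r la) k J) := ptensor [ffun l => << c l >>].
have mapP := @ucarrier_mapP _ (@form_deg r la) _ _ iota J.
have -> : ptensor [ffun l => << c l >>] =
    tensor_map iota (@ucarrier_map _ (@form_deg r la) k k' iota J) t.
  rewrite (tensor_mapE mapP); congr ptensor; apply/ffunP => l.
  by rewrite !ffunE /ucarrier_map free_liftU.
have -> : tensor_map idfun j' (tensor_map iota (ucarrier_map iota (J := J)) t) =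
    tensor_map iota (ext_in iota (V := V)) (tensor_map idfun j t).
  rewrite (tensor_mapE mapP) (tensor_mapE j'P) (tensor_mapE jP)
    (tensor_mapE (@ext_inP _ _ iota V)).
  by congr ptensor; apply/ffunP => l; rewrite !ffunE /= /ucarrier_map !free_liftU.
rewrite (form_extP k_char0 (lform V i) 
  (schur_ext_avg iota T (tensor_map idfun j t))) -schur_map_avg jE.
rewrite /= /ulform_fun rmorph_sum; apply: eq_bigr => S _.
rewrite -utensor_map; congr utensor.
by rewrite (avg_tensor_map mapP _ _ (x := y S)) // vsval_specht_ext.
Qed.

End BaseChangeEmbedding.

(** * Dimensions and conclusion *)

Lemma malg_finite_dim (k : fieldType) (K : finType) : finite_dim {malg k[K]}.
Proof.
exists #|K|; exists ((fun i : K => << i >>) \o enum_val).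
exact: is_basis_reindex (@enum_val_bij K) (malg_basis k K).
Qed.

Lemma malg_countable_dim (k : fieldType) (K : countType) (u : nat -> K) :
  injective u -> countable_dim {malg k[K]}.
Proof.
move=> u_inj.
have Kinf : infinite_set [set: K].
  apply/infiniteP; have uK := @inj_card_eq _ _ [set: nat]%classic u (in2W u_inj).
  rewrite -(card_le_eql uK); exact: subset_card_le.
have /card_set_bijP[f] := eq_card_nat (countableP [set: K]) Kinf.
rewrite setTT_bijective => -[h fK hK].
exists ((fun i : K => << i >>) \o h).
apply: is_basis_reindex (malg_basis k K); by exists f.
Qed.

Theorem theorem3p2 (k : fieldType) (k_char0 : [pchar k] =i pred0)
    (r : nat) (la : r.-tuple intpart) (la_pure : pure la) :
  [/\ exists V : lspace k la, countable_dim V /\ universal V,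
      forall d : nat, exists V : lspace k la, finite_dim V /\ d_universal d V &
      forall V : lspace k la, countable_dim V -> universal V ->
        forall (k' : fieldType) (iota : {rmorphism k -> k'}),
          universal (base_change iota k_char0 V)].
Proof.
have fact_neq0 n : (n`!%:R : k) != 0.
  by have /pcharf0P-> := k_char0; rewrite -lt0n fact_gt0.
pose U J := ulspace la_pure J (fun i => @specht_proj k (tnth la i)).
have U_universal (J : choiceType) d (u : 'I_d -> J) : injective u -> d_universal d (U J).
  move=> u_inj; apply: ulspace_universal u_inj _ _ => i; first exact: fact_neq0.
  by move=> x; exists (vsval x); exact: specht_projE.
have U_finite d : finite_dim (U 'I_d).
  exact: (malg_finite_dim k ('I_d + mons (@form_deg r la) 'I_d)%type).
split=> [|d|V Vcount Vuniv k' iota W [d Wd]].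
- exists (U nat); split=> [|W [d Wd]].
    apply: (@malg_countable_dim k (nat + mons (@form_deg r la) nat)%type inl).
    exact: inl_inj.
  exact: U_universal (@ord_inj d) _ Wd.
- by exists (U 'I_d); split=> //; exact: U_universal (@inj_id _).
(* Only the dimension [d] of [W] is used over [k]: [V] contains [U 'I_d], whose counterpart over
   [k'] receives [W]. *)
have := ulspace_base_change iota k_char0 Vcount (Vuniv _ (U_finite d)).
apply: embeds_trans.
apply: ulspace_universal (@inj_id _) _ _ _ Wd => i.
  by rewrite -(rmorph_nat iota) fmorph_eq0.
exact: specht_ext_span.
Qed.
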